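(* Fix $F>0$ and $\phi$ as in the context (in particular $\phi''_F>0$, $\phi''_{2F}<0$ and $\phi''_F+5\phi''_{2F}>0$), and let $$\lambda=\frac{(\phi''_F+2\phi''_{2F})+\sqrt{(\phi''_F)^2+4\phi''_F\phi''_{2F}}}{-2\phi''_{2F}}>1.$$ There is a constant $C>0$, independent of $h$, $K$ and $j$, such that for all integers $N,K$ with $2\le K\le N-2$ and $h=1/N$, the mean-zero $2N$-periodic solution $\mathbf{u}_{qc}$ of $L^{qc,h}\mathbf{u}_{qc}-\mathbf{g}=\mathbf{0}$ satisfies $$|(\mathbf{u}'_{qc})_j|\le C h$$ for all integers $j$ with $0\le j\le K+\frac{\ln h}{\ln\lambda}$ and for all integers $j$ with $K+2\le j\le N-1$, where $(\mathbf{u}')_j=(u_{j+1}-u_j)/h$. Thus the interface, i.e. the set of remaining indices $K+\frac{\ln h}{\ln\lambda}<j<K+2$ scaled by $h$, has size $O(h|\log h|)$.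
   Context: Setting. $F>0$ is fixed, $\phi\in C^2([r_0,\infty))$ for some $0<r_0<F$, and $\phi'_F:=\phi'(F)$, $\phi''_F:=\phi''(F)$, $\phi'_{2F}:=\phi'(2F)$, $\phi''_{2F}:=\phi''(2F)$. Standing assumptions: $\phi''_F>0$, $\phi''_{2F}<0$, $\phi''_F+5\phi''_{2F}>0$. $N$ is a positive integer and $h=1/N$. Displacements are real sequences $(u_j)_{j\in\mathbb{Z}}$ with $u_{j+2N}=u_j$, identified with $\mathbf{u}=(u_{-N+1},\dots,u_N)$. Per-atom energies. Put $q_1(s)=\phi'_F s+\tfrac12\phi''_F s^2$, $q_2(s)=\phi'_{2F}s+\tfrac12\phi''_{2F}s^2$, $q_c(s)=(\phi'_F+2\phi'_{2F})s+\tfrac12(\phi''_F+4\phi''_{2F})s^2$, and $$\mathcal{E}^{a,h}_j(\mathbf{u})=\tfrac12\Big[q_1\big(\tfrac{u_{j+1}-u_j}{h}\big)+q_2\big(\tfrac{u_{j+2}-u_j}{h}\big)\Big]+\tfrac12\Big[q_1\big(\tfrac{u_j-u_{j-1}}{h}\big)+q_2\big(\tfrac{u_j-u_{j-2}}{h}\big)\Big],$$ $$\mathcal{E}^{c,h}_j(\mathbf{u})=\tfrac12 q_c\big(\tfrac{u_{j+1}-u_j}{h}\big)+\tfrac12 q_c\big(\tfrac{u_j-u_{j-1}}{h}\big).$$ Quasicontinuum energy with zero external force, for $2\le K\le N-2$ (atoms $-K,\dots,K$ are atomistic, the others in the period are continuum): $$\mathcal{E}^{qc,h}(\mathbf{u})=h\Big[\sum_{j=-N+1}^{-K-1}\mathcal{E}^{c,h}_j(\mathbf{u})+\sum_{j=-K}^{K}\mathcal{E}^{a,h}_j(\mathbf{u})+\sum_{j=K+1}^{N}\mathcal{E}^{c,h}_j(\mathbf{u})\Big].$$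 This is a polynomial of degree at most two in $\mathbf{u}$; the linear operator $L^{qc,h}$ and the vector $\mathbf{g}$ (the ghost force) are defined by $$\frac1h\frac{\partial\mathcal{E}^{qc,h}}{\partial u_j}(\mathbf{u})=(L^{qc,h}\mathbf{u})_j-g_j\qquad(j=-N+1,\dots,N).$$ The equation $L^{qc,h}\mathbf{u}-\mathbf{g}=\mathbf{0}$ has solutions, unique up to an additive constant; $\mathbf{u}_{qc}$ denotes the one with $\sum_{j=-N+1}^N u_j=0$ (it is odd: $u_{-j}=-u_j$). *)

(* Defs.v *)
From Stdlib Require Import Reals ZArith List Lra Lia.
From Coquelicot Require Import Coquelicot.
Import ListNotations.
Open Scope R_scope.

(* Derivative relative to a domain [D]; one-sided at an endpoint of [D]. *)
Definition is_derive_in (D : R -> Prop) (f : R -> R) (x l : R) : Prop :=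
  filterlim (fun y => (f y - f x) / (y - x))
            (within (fun y => D y /\ y <> x) (locally x)) (locally l).

Definition continuous_in (D : R -> Prop) (f : R -> R) (x : R) : Prop :=
  filterlim f (within D (locally x)) (locally (f x)).

Definition C2_on (D : R -> Prop) (f : R -> R) : Prop :=
  exists f1 f2 : R -> R,
    forall x, D x ->
      is_derive_in D f x (f1 x) /\
      is_derive_in D f1 x (f2 x) /\
      continuous_in D f2 x.

(* Sum of [f j] over the integers [a <= j <= b]. *)
Definition sumZ (a b : Z) (f : Z -> R) : R :=
  fold_right Rplus 0
    (map (fun i : nat => f (a + Z.of_nat i)%Z) (seq 0 (Z.to_nat (b - a + 1)))).

Definition mesh (N : Z) : R := / IZR N.

(* Displacements are sequences indexed by all of [Z], kept [2N]-periodic. *)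
Definition periodic (N : Z) (u : Z -> R) : Prop :=
  forall j : Z, u (j + 2 * N)%Z = u j.

(* [phi'_F], [phi''_F], [phi'_{2F}], [phi''_{2F}] are obtained by taking
   [r = F] and [r = 2 * F]. *)
Definition dphi (phi : R -> R) (r : R) : R := Derive phi r.
Definition ddphi (phi : R -> R) (r : R) : R := Derive_n phi 2 r.

Definition q1 (phi : R -> R) (F s : R) : R :=
  dphi phi F * s + / 2 * ddphi phi F * s ^ 2.

Definition q2 (phi : R -> R) (F s : R) : R :=
  dphi phi (2 * F) * s + / 2 * ddphi phi (2 * F) * s ^ 2.

Definition qc (phi : R -> R) (F s : R) : R :=
  (dphi phi F + 2 * dphi phi (2 * F)) * s
  + / 2 * (ddphi phi F + 4 * ddphi phi (2 * F)) * s ^ 2.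

Definition Ea (phi : R -> R) (F : R) (N : Z) (u : Z -> R) (j : Z) : R :=
  / 2 * (q1 phi F ((u (j + 1)%Z - u j) / mesh N)
         + q2 phi F ((u (j + 2)%Z - u j) / mesh N))
  + / 2 * (q1 phi F ((u j - u (j - 1)%Z) / mesh N)
           + q2 phi F ((u j - u (j - 2)%Z) / mesh N)).

Definition Ec (phi : R -> R) (F : R) (N : Z) (u : Z -> R) (j : Z) : R :=
  / 2 * qc phi F ((u (j + 1)%Z - u j) / mesh N)
  + / 2 * qc phi F ((u j - u (j - 1)%Z) / mesh N).

Definition Eqc (phi : R -> R) (F : R) (N K : Z) (u : Z -> R) : R :=
  mesh N * (sumZ (- N + 1) (- K - 1) (Ec phi F N u)
            + sumZ (- K) K (Ea phi F N u)
            + sumZ (K + 1) N (Ec phi F N u)).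

(* The periodic extension of the [j]-th coordinate vector: moving the free
   variable [u_j] moves all of its periodic images. *)
Definition unit_disp (N j : Z) : Z -> R :=
  fun i => if ((i - j) mod (2 * N) =? 0)%Z then 1 else 0.

Definition line (u v : Z -> R) (t : R) : Z -> R := fun i => u i + t * v i.

(* The partial derivative of [Eqc] with respect to [u_j]. *)
Definition dEqc (phi : R -> R) (F : R) (N K : Z) (u : Z -> R) (j : Z) : R :=
  Derive (fun t => Eqc phi F N K (line u (unit_disp N j) t)) 0.

(* The identity [(1/h) dE/du_j (u) = (L u)_j - g_j] with [L] linear determines
   [g] (take [u = 0]) and then [L]; the facts [Lqc_linear] and
   [Lqc_ghost_spec] below show that these do satisfy it. *)
Definition ghost (phi : R -> R) (F : R) (N K : Z) (j : Z) : R :=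
  - (/ mesh N * dEqc phi F N K (fun _ => 0) j).

Definition Lqc (phi : R -> R) (F : R) (N K : Z) (u : Z -> R) (j : Z) : R :=
  / mesh N * dEqc phi F N K u j + ghost phi F N K j.

Definition is_uqc (phi : R -> R) (F : R) (N K : Z) (u : Z -> R) : Prop :=
  periodic N u /\
  sumZ (- N + 1) N u = 0 /\
  (forall j : Z, (- N + 1 <= j <= N)%Z ->
     Lqc phi F N K u j - ghost phi F N K j = 0).

Definition strain (N : Z) (u : Z -> R) (j : Z) : R :=
  (u (j + 1)%Z - u j) / mesh N.

Definition lam (phi : R -> R) (F : R) : R :=
  ((ddphi phi F + 2 * ddphi phi (2 * F))
   + sqrt (ddphi phi F ^ 2 + 4 * ddphi phi F * ddphi phi (2 * F)))
  / (- 2 * ddphi phi (2 * F)).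

Definition in_interface (phi : R -> R) (F : R) (N K j : Z) : Prop :=
  IZR K + ln (mesh N) / ln (lam phi F) < IZR j < IZR K + 2.

Section Derivative.
Variables (phi : R -> R) (F : R) (N : Z).

Definition dq (p s : R) (x y : R) : R := (p + s * x) * y.

Definition dEa (u v : Z -> R) (j : Z) : R :=
  let D w a b := (w a - w b) / mesh N in
  / 2 * (dq (dphi phi F) (ddphi phi F) (D u (j + 1)%Z j) (D v (j + 1)%Z j)
         + dq (dphi phi (2 * F)) (ddphi phi (2 * F)) (D u (j + 2)%Z j) (D v (j + 2)%Z j))
  + / 2 * (dq (dphi phi F) (ddphi phi F) (D u j (j - 1)%Z) (D v j (j - 1)%Z)
         + dq (dphi phi (2 * F)) (ddphi phi (2 * F)) (D u j (j - 2)%Z) (D v j (j - 2)%Z)).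

Definition dEc (u v : Z -> R) (j : Z) : R :=
  let D w a b := (w a - w b) / mesh N in
  let p := dphi phi F + 2 * dphi phi (2 * F) in
  let s := ddphi phi F + 4 * ddphi phi (2 * F) in
  / 2 * dq p s (D u (j + 1)%Z j) (D v (j + 1)%Z j)
  + / 2 * dq p s (D u j (j - 1)%Z) (D v j (j - 1)%Z).

Definition dE (K : Z) (u v : Z -> R) : R :=
  mesh N * (sumZ (- N + 1) (- K - 1) (dEc u v)
            + sumZ (- K) K (dEa u v)
            + sumZ (K + 1) N (dEc u v)).

Lemma is_derive_sumZ (a b : Z) (f : R -> Z -> R) (df : Z -> R) (x : R) :
  (forall j, is_derive (fun t => f t j) x (df j)) ->
  is_derive (fun t => sumZ a b (f t)) x (sumZ a b df).
Proof.
intros H; unfold sumZ.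
induction (seq 0 (Z.to_nat (b - a + 1))) as [|i l IH]; simpl.
- exact (is_derive_const (V := R_NormedModule) 0 x).
- exact (is_derive_plus (V := R_NormedModule) _ _ x _ _ (H _) IH).
Qed.

Lemma sumZ_affine (a b : Z) (f f1 f2 f0 : Z -> R) (c1 c2 : R) :
  (forall j, f j - f0 j = c1 * (f1 j - f0 j) + c2 * (f2 j - f0 j)) ->
  sumZ a b f - sumZ a b f0
  = c1 * (sumZ a b f1 - sumZ a b f0) + c2 * (sumZ a b f2 - sumZ a b f0).
Proof.
intros H; unfold sumZ.
induction (seq 0 (Z.to_nat (b - a + 1))) as [|i l IH]; simpl; [ring|].
specialize (H (a + Z.of_nat i)%Z); lra.
Qed.

Lemma is_derive_Eqc (K : Z) (u v : Z -> R) :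
  is_derive (fun t => Eqc phi F N K (line u v t)) 0 (dE K u v).
Proof.
unfold Eqc, dE.
apply (is_derive_scal
  (fun t => sumZ (- N + 1) (- K - 1) (Ec phi F N (line u v t))
    + sumZ (- K) K (Ea phi F N (line u v t))
    + sumZ (K + 1) N (Ec phi F N (line u v t)))).
apply (is_derive_plus (V := R_NormedModule)); [
  apply (is_derive_plus (V := R_NormedModule)) | ];
  apply is_derive_sumZ; intros j;
  unfold Ea, Ec, dEa, dEc, q1, q2, qc, dq, line, Rdiv;
  generalize (/ mesh N); intros m;
  auto_derive; trivial; field.
Qed.

Lemma dEqc_explicit (K : Z) (u : Z -> R) (j : Z) :
  dEqc phi F N K u j = dE K u (unit_disp N j).
Proof. apply is_derive_unique, is_derive_Eqc. Qed.

Lemma Lqc_linear (K : Z) (c1 c2 : R) (u1 u2 : Z -> R) (j : Z) :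
  Lqc phi F N K (fun i => c1 * u1 i + c2 * u2 i) j
  = c1 * Lqc phi F N K u1 j + c2 * Lqc phi F N K u2 j.
Proof.
set (u := fun i => c1 * u1 i + c2 * u2 i).
set (e := unit_disp N j).
assert (Hc : forall i, dEc u e i - dEc (fun _ => 0) e i =
  c1 * (dEc u1 e i - dEc (fun _ => 0) e i)
  + c2 * (dEc u2 e i - dEc (fun _ => 0) e i)).
{ intros i; unfold dEc, dq, u, Rdiv; ring. }
assert (Ha : forall i, dEa u e i - dEa (fun _ => 0) e i =
  c1 * (dEa u1 e i - dEa (fun _ => 0) e i)
  + c2 * (dEa u2 e i - dEa (fun _ => 0) e i)).
{ intros i; unfold dEa, dq, u, Rdiv; ring. }
assert (H1 := sumZ_affine (- N + 1) (- K - 1) _ _ _ _ _ _ Hc).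
assert (H2 := sumZ_affine (- K) K _ _ _ _ _ _ Ha).
assert (H3 := sumZ_affine (K + 1) N _ _ _ _ _ _ Hc).
assert (H : dE K u e - dE K (fun _ => 0) e =
  c1 * (dE K u1 e - dE K (fun _ => 0) e)
  + c2 * (dE K u2 e - dE K (fun _ => 0) e)).
{ unfold dE; rewrite <- !Rmult_minus_distr_l.
  transitivity (mesh N *
   ((sumZ (- N + 1) (- K - 1) (dEc u e) - sumZ (- N + 1) (- K - 1) (dEc (fun _ => 0) e))
    + (sumZ (- K) K (dEa u e) - sumZ (- K) K (dEa (fun _ => 0) e))
    + (sumZ (K + 1) N (dEc u e) - sumZ (K + 1) N (dEc (fun _ => 0) e)))); [ring|].
  rewrite H1, H2, H3; ring. }
unfold Lqc, ghost; rewrite !dEqc_explicit; fold e.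
transitivity (/ mesh N * (dE K u e - dE K (fun _ => 0) e)); [ring|].
rewrite H; ring.
Qed.

Lemma Lqc_ghost_spec (K : Z) (u : Z -> R) (j : Z) : (0 < N)%Z ->
  is_derive (fun t => Eqc phi F N K (line u (unit_disp N j) t)) 0
            (mesh N * (Lqc phi F N K u j - ghost phi F N K j)).
Proof.
intros HN.
assert (Hm : mesh N <> 0)
  by (unfold mesh; apply Rinv_neq_0_compat, not_0_IZR; lia).
replace (mesh N * (Lqc phi F N K u j - ghost phi F N K j))
  with (dE K u (unit_disp N j)).
- apply is_derive_Eqc.
- unfold Lqc; rewrite dEqc_explicit; field; exact Hm.
Qed.

End Derivative.

(* Main.v *)
Require Import Defs.
From Stdlib Require Import Reals ZArith List Lra Lia.
From Coquelicot Require Import Coquelicot.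
Open Scope R_scope.

(* The derivative of the energy in direction [v] is a period sum of stress times
   the strain of [v], so [u] is an equilibrium iff the stress of its strain [s] is
   constant.  The stress of a constant strain [s0] deviates from a constant by
   -(q + 2 b s0) f with q = phi'_{2F}, b = phi''_{2F} and f (here [jump]) equal to
   1/2 at the bonds K-1, -K, to -1/2 at the bonds K+1, -K-2, and 0 elsewhere.
   Hence s = s0 + (q + 2 b s0) r, where r solves A r = f for the linear part A of
   the stress.  This r vanishes beyond K+1, and in the atomistic region it is a
   multiple of lam^i + lam^(-1-i), so it is of size lam^(i-K).
   Mean zero reads 2N s0 + (q + 2 b s0) S = 0 with S the sum of r; summing A r = f
   gives (a + 4b) S = 2 b <f, r>, where a = phi''_F, and <f, r> = <A r, r> >= 0, so
   b S >= 0 and s0 = O(h).  Coercivity <A s, s> >= (a + 5b) |s|^2 gives uniqueness. *)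

(** * Induction on integer intervals and finite sums *)

(** The base case is the empty interval, [b = a - 1], so that the sum identities below cover empty
    ranges. *)
Lemma interval_ind (a : Z) (P : Z -> Prop) :
  P (a - 1)%Z -> (forall b, (a <= b)%Z -> P (b - 1)%Z -> P b) ->
  forall b, (a - 1 <= b)%Z -> P b.
Proof.
intros H0 HS b Hb.
replace b with (a - 1 + Z.of_nat (Z.to_nat (b - (a - 1))))%Z by lia.
induction (Z.to_nat (b - (a - 1))) as [|n IH].
- now replace (a - 1 + Z.of_nat 0)%Z with (a - 1)%Z by lia.
- apply HS; [lia|].
  now replace (a - 1 + Z.of_nat (S n) - 1)%Z with (a - 1 + Z.of_nat n)%Z by lia.
Qed.

Lemma sumZ_nil (a b : Z) (f : Z -> R) : (b < a)%Z -> sumZ a b f = 0.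
Proof.
intros H; unfold sumZ.
now replace (Z.to_nat (b - a + 1)) with 0%nat by lia.
Qed.

Lemma sumZ_last (a b : Z) (f : Z -> R) :
  (a <= b)%Z -> sumZ a b f = sumZ a (b - 1) f + f b.
Proof.
intros H; unfold sumZ.
replace (Z.to_nat (b - a + 1)) with (S (Z.to_nat (b - 1 - a + 1))) by lia.
rewrite seq_S, map_app, fold_right_app; simpl.
replace (a + Z.of_nat (Z.to_nat (b - 1 - a + 1)))%Z with b by lia.
generalize (seq 0 (Z.to_nat (b - 1 - a + 1))); intros l.
induction l as [|i l IH]; simpl; [ring|].
rewrite IH; ring.
Qed.

Lemma sumZ_ext (a b : Z) (f g : Z -> R) :
  (forall j, (a <= j <= b)%Z -> f j = g j) -> sumZ a b f = sumZ a b g.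
Proof.
destruct (Z_lt_le_dec b (a - 1)) as [Hb|Hb].
{ intros _; rewrite !sumZ_nil by lia; reflexivity. }
revert b Hb; apply (interval_ind a (fun b =>
  (forall j, (a <= j <= b)%Z -> f j = g j) -> sumZ a b f = sumZ a b g)).
- intros _; rewrite !sumZ_nil by lia; reflexivity.
- intros b Hb IH H; rewrite !(sumZ_last a b) by lia.
  rewrite IH, H; [reflexivity|lia|]; intros; apply H; lia.
Qed.

Lemma sumZ_cat (a m b : Z) (f : Z -> R) : (a - 1 <= m <= b)%Z ->
  sumZ a b f = sumZ a m f + sumZ (m + 1) b f.
Proof.
intros [Ha Hb].
assert (Hb' : (m + 1 - 1 <= b)%Z) by lia; clear Hb; revert b Hb'.
apply (interval_ind (m + 1) (fun b =>
  sumZ a b f = sumZ a m f + sumZ (m + 1) b f)).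
- rewrite (sumZ_nil (m + 1)) by lia.
  replace (m + 1 - 1)%Z with m by lia; ring.
- intros b Hb IH; rewrite (sumZ_last a), (sumZ_last (m + 1)), IH by lia; ring.
Qed.

Lemma sumZ_lin (a b : Z) (c d : R) (f g : Z -> R) :
  sumZ a b (fun j => c * f j + d * g j) = c * sumZ a b f + d * sumZ a b g.
Proof.
unfold sumZ; induction (seq 0 (Z.to_nat (b - a + 1))) as [|i l IH]; simpl;
  [ring|rewrite IH; ring].
Qed.

Lemma sumZ_const (a b : Z) (c : R) : (a - 1 <= b)%Z ->
  sumZ a b (fun _ => c) = IZR (b - a + 1) * c.
Proof.
revert b; apply (interval_ind a (fun b => sumZ a b (fun _ => c) = IZR (b - a + 1) * c)).
- rewrite sumZ_nil by lia; replace (a - 1 - a + 1)%Z with 0%Z by lia; ring.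
- intros b Hb IH; rewrite sumZ_last, IH by lia.
  rewrite !plus_IZR, !minus_IZR; ring.
Qed.

Lemma sumZ_nonneg (a b : Z) (f : Z -> R) :
  (forall j, 0 <= f j) -> 0 <= sumZ a b f.
Proof.
intros H; unfold sumZ.
induction (seq 0 (Z.to_nat (b - a + 1))) as [|i l IH]; simpl; [lra|].
specialize (H (a + Z.of_nat i)%Z); lra.
Qed.

Lemma sumZ_le (a b : Z) (f g : Z -> R) :
  (forall j, f j <= g j) -> sumZ a b f <= sumZ a b g.
Proof.
intros H.
assert (H1 := sumZ_nonneg a b (fun j => 1 * g j + (-1) * f j)).
rewrite sumZ_lin in H1.
enough (0 <= 1 * sumZ a b g + -1 * sumZ a b f) by lra.
apply H1; intros j; specialize (H j); lra.
Qed.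

Lemma sumZ_telescope (a b : Z) (H : Z -> R) : (a - 1 <= b)%Z ->
  sumZ a b (fun j => H (j + 1)%Z - H j) = H (b + 1)%Z - H a.
Proof.
revert b; apply (interval_ind a (fun b =>
  sumZ a b (fun j => H (j + 1)%Z - H j) = H (b + 1)%Z - H a)).
- rewrite sumZ_nil by lia; replace (a - 1 + 1)%Z with a by lia; ring.
- intros b Hb IH; rewrite sumZ_last, IH by lia.
  replace (b - 1 + 1)%Z with b by lia; ring.
Qed.

Lemma sumZ_eqb (a b j : Z) (g : Z -> R) : (a - 1 <= b)%Z ->
  sumZ a b (fun i => g i * (if (i =? j)%Z then 1 else 0))
  = if ((a <=? j) && (j <=? b))%bool%Z then g j else 0.
Proof.
revert b; apply (interval_ind a (fun b =>
  sumZ a b (fun i => g i * (if (i =? j)%Z then 1 else 0))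
  = if ((a <=? j) && (j <=? b))%bool%Z then g j else 0)).
- rewrite sumZ_nil by lia.
  destruct (Z.leb_spec a j), (Z.leb_spec j (a - 1)); simpl; trivial; lia.
- intros b Hb IH; rewrite sumZ_last, IH by lia.
  destruct (Z.leb_spec a j), (Z.leb_spec j b), (Z.leb_spec j (b - 1)),
    (Z.eqb_spec b j); subst; simpl; try lia; ring.
Qed.

(** * Residues modulo the period and periodic summation by parts *)

(** The window of representatives is -N, ..., N-1, not the range -N+1, ..., N of the sums, because
    it is invariant under i -> -1-i, the action on bonds of the reflection about atom 0. *)
Definition cell (N j : Z) : Z := ((j + N) mod (2 * N) - N)%Z.

Lemma cell_bounds (N j : Z) : (0 < N)%Z -> (- N <= cell N j <= N - 1)%Z.
Proof.
intros HN; unfold cell.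
assert (H := Z.mod_pos_bound (j + N) (2 * N) ltac:(lia)); lia.
Qed.

Lemma cell_id (N j : Z) : (- N <= j <= N - 1)%Z -> cell N j = j.
Proof. intros H; unfold cell; rewrite Z.mod_small; lia. Qed.

Lemma cell_add (N j k : Z) : cell N (j + 2 * N * k) = cell N j.
Proof.
unfold cell; f_equal.
replace (j + 2 * N * k + N)%Z with (j + N + k * (2 * N))%Z by ring.
apply Z_mod_plus_full.
Qed.

Lemma cell_decomp (N j : Z) : (0 < N)%Z -> exists k, j = (cell N j + 2 * N * k)%Z.
Proof.
intros HN; exists ((j + N) / (2 * N))%Z; unfold cell.
assert (H := Z.div_mod (j + N) (2 * N) ltac:(lia)); lia.
Qed.

Lemma periodic_mul (N : Z) (u : Z -> R) : periodic N u ->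
  forall j k : Z, u (j + 2 * N * k)%Z = u j.
Proof.
intros Hu.
assert (Hn : forall n j, u (j + 2 * N * Z.of_nat n)%Z = u j).
{ induction n as [|n IH]; intros j.
  - f_equal; lia.
  - replace (j + 2 * N * Z.of_nat (S n))%Z
      with (j + 2 * N * Z.of_nat n + 2 * N)%Z by lia.
    rewrite Hu; apply IH. }
intros j k; destruct (Z_le_gt_dec 0 k) as [Hk|Hk].
- replace k with (Z.of_nat (Z.to_nat k)) by lia; apply Hn.
- rewrite <- (Hn (Z.to_nat (- k)) (j + 2 * N * k)%Z); f_equal.
  rewrite Z2Nat.id by lia; ring.
Qed.

Lemma periodic_cell (N j : Z) (u : Z -> R) :
  (0 < N)%Z -> periodic N u -> u (cell N j) = u j.
Proof.
intros HN Hu; destruct (cell_decomp N j HN) as [k Hk].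
rewrite Hk at 2; symmetry; apply periodic_mul, Hu.
Qed.

Lemma periodic_ext (N : Z) (u v : Z -> R) :
  (0 < N)%Z -> periodic N u -> periodic N v ->
  (forall j, (- N <= j <= N - 1)%Z -> u j = v j) -> forall j, u j = v j.
Proof.
intros HN Hu Hv H j.
rewrite <- (periodic_cell N j u), <- (periodic_cell N j v) by assumption.
apply H, cell_bounds, HN.
Qed.

(** The vehicle of every summation by parts below: a certificate [H] is exhibited, and its
    increments telescope to zero over a period. *)
Lemma sumZ_le_periodic (N : Z) (f g H : Z -> R) : (0 < N)%Z -> periodic N H ->
  (forall j, f j <= g j + (H (j + 1)%Z - H j)) ->
  sumZ (- N + 1) N f <= sumZ (- N + 1) N g.
Proof.
intros HN HH Hle.
apply Rle_trans with (1 := sumZ_le _ _ _ _ Hle).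
rewrite (sumZ_ext _ _ _ (fun j => 1 * g j + 1 * (H (j + 1)%Z - H j)))
  by (intros; ring).
rewrite sumZ_lin, sumZ_telescope by lia.
replace (N + 1)%Z with (- N + 1 + 2 * N)%Z by lia; rewrite HH; lra.
Qed.

Lemma sumZ_eq_periodic (N : Z) (f g H : Z -> R) : (0 < N)%Z -> periodic N H ->
  (forall j, f j = g j + (H (j + 1)%Z - H j)) ->
  sumZ (- N + 1) N f = sumZ (- N + 1) N g.
Proof.
intros HN HH Heq; apply Rle_antisym.
- apply (sumZ_le_periodic N f g H); trivial; intros j; rewrite Heq; lra.
- apply (sumZ_le_periodic N g f (fun j => - H j)); trivial.
  + intros j; now rewrite HH.
  + intros j; rewrite Heq; lra.
Qed.

Lemma periodic_shift (N : Z) (u : Z -> R) (k : Z) :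
  periodic N u -> periodic N (fun j => u (j + k)%Z).
Proof.
intros Hu j; cbv beta.
replace (j + 2 * N + k)%Z with (j + k + 2 * N)%Z by lia; apply Hu.
Qed.

Lemma periodic_unit_disp (N j : Z) : periodic N (unit_disp N j).
Proof.
intros i; unfold unit_disp.
replace (i + 2 * N - j)%Z with (i - j + 1 * (2 * N))%Z by ring.
now rewrite Z_mod_plus_full.
Qed.

Lemma unit_disp_near (N j i : Z) : (0 < N)%Z -> (Z.abs (i - j) < 2 * N)%Z ->
  unit_disp N j i = if (i =? j)%Z then 1 else 0.
Proof.
intros HN H; unfold unit_disp.
destruct (Z.eqb_spec i j) as [->|Hij].
- now rewrite Z.sub_diag, Zmod_0_l.
- destruct (Z_le_gt_dec 0 (i - j)).
  + rewrite Z.mod_small by lia; destruct (Z.eqb_spec (i - j) 0); trivial; lia.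
  + rewrite <- (Z_mod_plus_full (i - j) 1), Z.mod_small by lia.
    destruct (Z.eqb_spec (i - j + 1 * (2 * N)) 0); trivial; lia.
Qed.

Lemma unit_disp_add (N j k i : Z) :
  unit_disp N (j + 2 * N * k) i = unit_disp N j i.
Proof.
unfold unit_disp.
replace (i - (j + 2 * N * k))%Z with (i - j + (- k) * (2 * N))%Z by ring.
now rewrite Z_mod_plus_full.
Qed.

Lemma sumZ_unit_disp (N j : Z) (g : Z -> R) : (0 < N)%Z -> periodic N g ->
  sumZ (- N + 1) N (fun i => g i * unit_disp N j i) = g j.
Proof.
intros HN Hg.
assert (Hw : forall j, (- N + 1 <= j <= N)%Z ->
  sumZ (- N + 1) N (fun i => g i * unit_disp N j i) = g j).
{ clear j; intros j Hj.
  rewrite (sumZ_ext _ _ _ (fun i => g i * (if (i =? j)%Z then 1 else 0))).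
  - rewrite sumZ_eqb by lia.
    destruct (Z.leb_spec (- N + 1) j), (Z.leb_spec j N); trivial; lia.
  - intros i Hi; rewrite unit_disp_near; trivial; lia. }
destruct (cell_decomp N (j - 1) HN) as [k Hk].
assert (Hb := cell_bounds N (j - 1) HN).
replace j with (cell N (j - 1) + 1 + 2 * N * k)%Z by lia.
rewrite periodic_mul by assumption.
rewrite <- (Hw (cell N (j - 1) + 1)%Z) by lia.
apply sumZ_ext; intros i _; now rewrite unit_disp_add.
Qed.

(** * Atomistic weights and the stress *)

Definition atomistic (N K j : Z) : R :=
  if (Z.abs (cell N j) <=? K)%Z then 1 else 0.

Lemma periodic_cell_fun (N : Z) (f : Z -> R) : periodic N (fun j => f (cell N j)).
Proof.
intros j; replace (j + 2 * N)%Z with (j + 2 * N * 1)%Z by ring.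
now rewrite cell_add.
Qed.

Lemma periodic_atomistic (N K : Z) : periodic N (atomistic N K).
Proof.
exact (periodic_cell_fun N (fun j => if (Z.abs j <=? K)%Z then 1 else 0)).
Qed.

(** The range contains all stencils i-1, ..., i+2 of bonds i in the window of [cell]. Past the
    window, the representative of [j] has modulus at least N-1 > K, so the atom is a continuum
    one. *)
Lemma atomistic_near (N K j : Z) : (2 <= K <= N - 2)%Z ->
  (- N - 1 <= j <= N + 1)%Z ->
  atomistic N K j = if (Z.abs j <=? K)%Z then 1 else 0.
Proof.
intros HK Hj; unfold atomistic.
destruct (Z_lt_le_dec j (- N)) as [Hl|Hl];
  [|destruct (Z_lt_le_dec (N - 1) j) as [Hr|Hr]].
- replace j with (j + 2 * N + 2 * N * (-1))%Z at 1 by ring.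
  rewrite cell_add, cell_id by lia.
  destruct (Z.leb_spec (Z.abs (j + 2 * N)) K), (Z.leb_spec (Z.abs j) K);
    trivial; lia.
- replace j with (j - 2 * N + 2 * N * 1)%Z at 1 by ring.
  rewrite cell_add, cell_id by lia.
  destruct (Z.leb_spec (Z.abs (j - 2 * N)) K), (Z.leb_spec (Z.abs j) K);
    trivial; lia.
- now rewrite cell_id by lia.
Qed.

Lemma atomistic_01 (N K j : Z) : atomistic N K j = 0 \/ atomistic N K j = 1.
Proof. unfold atomistic; destruct (Z.leb _ _); auto. Qed.

(* The fractions of the energy of the bonds (i, i+1) and (i, i+2) that are
   counted atomistically when [chi] marks the atomistic atoms. *)
Definition w1 (chi : Z -> R) (i : Z) : R := / 2 * (chi i + chi (i + 1)%Z).
Definition w2 (chi : Z -> R) (i : Z) : R := / 2 * (chi i + chi (i + 2)%Z).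

(** The coefficient of the test strain at bond (i, i+1) in the first variation: the bond itself,
    split between both models, and the two second-neighbour bonds (i, i+2) and (i-1, i+1) that
    contain it. With [p = q = 0] it is the linear operator A. *)
Definition stress (p q a b : R) (chi s : Z -> R) (i : Z) : R :=
  w1 chi i * (p + a * s i)
  + (1 - w1 chi i) * (p + 2 * q + (a + 4 * b) * s i)
  + w2 chi i * (q + b * (s i + s (i + 1)%Z))
  + w2 chi (i - 1) * (q + b * (s (i - 1)%Z + s i)).

(** This is [2 * w1 chi i - w2 chi i - w2 chi (i - 1)], the mismatch of the first- and
    second-neighbour weights. *)
Definition jump (chi : Z -> R) (i : Z) : R :=
  / 2 * (chi i + chi (i + 1)%Z - chi (i + 2)%Z - chi (i - 1)%Z).

Lemma periodic_w1 (N : Z) (chi : Z -> R) : periodic N chi -> periodic N (w1 chi).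
Proof.
intros H j; unfold w1.
now rewrite H, (periodic_shift N chi 1 H).
Qed.

Lemma periodic_w2 (N : Z) (chi : Z -> R) : periodic N chi -> periodic N (w2 chi).
Proof.
intros H j; unfold w2.
now rewrite H, (periodic_shift N chi 2 H).
Qed.

Lemma periodic_stress (N : Z) (p q a b : R) (chi s : Z -> R) :
  periodic N chi -> periodic N s -> periodic N (stress p q a b chi s).
Proof.
intros Hc Hs j; unfold stress.
assert (H1 := periodic_w1 N chi Hc); assert (H2 := periodic_w2 N chi Hc).
rewrite H1, H2, Hs, (periodic_shift N s 1 Hs).
rewrite (periodic_shift N s (-1) Hs : forall j, s (j + 2 * N - 1)%Z = _).
now rewrite (periodic_shift N _ (-1) H2 : forall j, w2 chi (j + 2 * N - 1)%Z = _).
Qed.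

Lemma periodic_jump (N : Z) (chi : Z -> R) :
  periodic N chi -> periodic N (jump chi).
Proof.
intros H j; unfold jump.
rewrite H, (periodic_shift N chi 1 H), (periodic_shift N chi 2 H).
now rewrite (periodic_shift N chi (-1) H : forall j, chi (j + 2 * N - 1)%Z = _).
Qed.

Lemma periodic_strain (N : Z) (u : Z -> R) : periodic N u -> periodic N (strain N u).
Proof.
intros H j; unfold strain; now rewrite H, (periodic_shift N u 1 H).
Qed.

Lemma mesh_pos (N : Z) : (0 < N)%Z -> 0 < mesh N.
Proof. intros H; apply Rinv_0_lt_compat, IZR_lt, H. Qed.

(** * The first variation as a pairing with the stress *)

Lemma dE_atomistic (phi : R -> R) (F : R) (N K : Z) (u v : Z -> R) :
  (2 <= K <= N - 2)%Z ->
  dE phi F N K u v = mesh N * sumZ (- N + 1) N (fun j =>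
    atomistic N K j * dEa phi F N u v j
    + (1 - atomistic N K j) * dEc phi F N u v j).
Proof.
intros HK; unfold dE; f_equal.
rewrite (sumZ_cat (- N + 1) K N), (sumZ_cat (- N + 1) (- K - 1) K) by lia.
replace (- K - 1 + 1)%Z with (- K)%Z by lia.
f_equal; [f_equal|]; apply sumZ_ext; intros j Hj; rewrite atomistic_near by lia;
  destruct (Z.leb_spec (Z.abs j) K); try lia; ring.
Qed.

Lemma dE_stress (phi : R -> R) (F : R) (N K : Z) (u v : Z -> R) :
  (2 <= K <= N - 2)%Z -> periodic N u -> periodic N v ->
  let sigma := stress (dphi phi F) (dphi phi (2 * F)) (ddphi phi F)
                 (ddphi phi (2 * F)) (atomistic N K) (strain N u) in
  dE phi F N K u v
  = sumZ (- N + 1) N (fun j => (sigma (j - 1)%Z - sigma j) * v j).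
Proof.
intros HK Hu Hv sigma.
assert (Hm := mesh_pos N ltac:(lia)).
rewrite dE_atomistic by assumption.
(* A zero sum is added so that [sumZ_lin] can absorb the factor [mesh N]. *)
rewrite <- (Rplus_0_r (mesh N * _)), <- (Rmult_0_l (sumZ (- N + 1) N (fun _ => 0))).
rewrite <- sumZ_lin.
set (chi := atomistic N K).
assert (Hchi : periodic N chi) by apply periodic_atomistic.
set (s := strain N u) in *; set (t := strain N v).
assert (Hs : periodic N s) by apply periodic_strain, Hu.
assert (Ht : periodic N t) by apply periodic_strain, Hv.
assert (Hsig : periodic N sigma) by (apply periodic_stress; assumption).
assert (Hw2 := periodic_w2 N chi Hchi).
set (p := dphi phi F) in *; set (q := dphi phi (2 * F)) in *.
set (a := ddphi phi F) in *; set (b := ddphi phi (2 * F)) in *.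
set (B := fun j => q + b * (s j + s (j + 1)%Z)).
set (G1 := fun j => (p + a * s j) * t j).
set (G2 := fun j => B j * (t j + t (j + 1)%Z)).
set (G3 := fun j => (p + 2 * q + (a + 4 * b) * s j) * t j).
assert (HB : periodic N B)
  by (intros j; unfold B; now rewrite Hs, (periodic_shift N s 1 Hs)).
assert (HG1 : periodic N G1) by (intros j; unfold G1; now rewrite Hs, Ht).
assert (HG2 : periodic N G2)
  by (intros j; unfold G2; now rewrite HB, Ht, (periodic_shift N t 1 Ht)).
assert (HG3 : periodic N G3) by (intros j; unfold G3; now rewrite Hs, Ht).
(* The certificate has three groups: the halves carried by backward bonds move to their left ends
   (two steps for second neighbours, hence two [G2] terms); the [w2] term attributes each
   second-neighbour bond to its two strains; [sigma (j - 1) * v j] is Abel summation. *)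
apply (sumZ_eq_periodic N _ _ (fun j =>
  - mesh N * (/ 2 * (chi j * G1 (j - 1)%Z + (1 - chi j) * G3 (j - 1)%Z
              + chi j * G2 (j - 2)%Z + chi (j + 1)%Z * G2 (j - 1)%Z)
  - w2 chi (j - 1) * B (j - 1)%Z * t j) + sigma (j - 1)%Z * v j)); [lia| |].
- intros j.
  rewrite Hchi, Ht, Hv, (periodic_shift N chi 1 Hchi).
  rewrite (periodic_shift N B (-1) HB : forall j, B (j + 2 * N - 1)%Z = _).
  rewrite (periodic_shift N _ (-1) Hsig : forall j, sigma (j + 2 * N - 1)%Z = _).
  rewrite (periodic_shift N _ (-1) HG1 : forall j, G1 (j + 2 * N - 1)%Z = _).
  rewrite (periodic_shift N _ (-1) HG2 : forall j, G2 (j + 2 * N - 1)%Z = _).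
  rewrite (periodic_shift N _ (-1) HG3 : forall j, G3 (j + 2 * N - 1)%Z = _).
  rewrite (periodic_shift N _ (-2) HG2 : forall j, G2 (j + 2 * N - 2)%Z = _).
  rewrite (periodic_shift N _ (-1) Hw2 : forall j, w2 chi (j + 2 * N - 1)%Z = _).
  reflexivity.
- intros j.
  assert (Et : forall w i, (w (i + 1)%Z - w i) / mesh N = strain N w i)
    by reflexivity.
  assert (Et1 : forall w i, (w i - w (i - 1)%Z) / mesh N = strain N w (i - 1)%Z).
  { intros w i; unfold strain; now replace (i - 1 + 1)%Z with i by lia. }
  assert (Et2 : forall w i, (w (i + 2)%Z - w i) / mesh N
                = strain N w i + strain N w (i + 1)%Z).
  { intros w i; unfold strain; replace (i + 1 + 1)%Z with (i + 2)%Z by lia.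
    unfold Rdiv; ring. }
  assert (Et3 : forall w i, (w i - w (i - 2)%Z) / mesh N
                = strain N w (i - 2)%Z + strain N w (i - 1)%Z).
  { intros w i; unfold strain; replace (i - 1 + 1)%Z with i by lia.
    replace (i - 2 + 1)%Z with (i - 1)%Z by lia; unfold Rdiv; ring. }
  assert (Ev : v (j + 1)%Z = v j + mesh N * t j).
  { unfold t, strain; field; lra. }
  unfold dEa, dEc, dq; cbv zeta.
  rewrite !Et, !Et1, !Et2, !Et3.
  fold p q a b s t.
  replace (j + 1 - 1)%Z with j by lia.
  replace (j + 1 - 2)%Z with (j - 1)%Z by lia.
  replace (j + 1 + 1)%Z with (j + 2)%Z by lia.
  rewrite Ev.
  unfold sigma at 2 3; unfold stress.
  unfold G1, G2, G3, B, w1, w2.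
  replace (j - 1 + 1)%Z with j by lia.
  replace (j - 2 + 1)%Z with (j - 1)%Z by lia.
  replace (j - 1 + 2)%Z with (j + 1)%Z by lia.
fold chi; field.
Qed.

(** * Affine structure, coercivity and total of the stress *)

(** On a uniform strain the force [q + 2 * b * s0] is counted [2 * (1 - w1 chi i)] times through the
    continuum law and [w2 chi i + w2 chi (i - 1)] times through the bonds; the total falls short of
    2 by [jump chi i]. *)
Lemma stress_affine (p q a b s0 g : R) (chi r : Z -> R) (i : Z) :
  stress p q a b chi (fun j => s0 + g * r j) i
  = p + 2 * q + (a + 4 * b) * s0 - (q + 2 * b * s0) * jump chi i
    + g * stress 0 0 a b chi r i.
Proof.
unfold stress, jump, w1, w2.
replace (i - 1 + 2)%Z with (i + 1)%Z by lia; field.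
Qed.

Lemma stress_minus (p q a b : R) (chi s t : Z -> R) (i : Z) :
  stress p q a b chi s i - stress p q a b chi t i
  = stress 0 0 a b chi (fun j => s j - t j) i.
Proof. unfold stress; ring. Qed.

Lemma stress_coercive (N : Z) (a b : R) (chi s : Z -> R) :
  (0 < N)%Z -> b < 0 -> periodic N chi -> periodic N s ->
  (forall i, 0 <= chi i) -> (forall i, - / 2 <= jump chi i) ->
  (a + 5 * b) * sumZ (- N + 1) N (fun i => s i * s i)
  <= sumZ (- N + 1) N (fun i => stress 0 0 a b chi s i * s i).
Proof.
intros HN Hb Hc Hs H0 Hj.
rewrite <- (Rplus_0_r (_ * _)), <- (Rmult_0_l (sumZ (- N + 1) N (fun _ => 0))).
rewrite <- sumZ_lin.
(* [b w2 (s_i + s_(i+1))^2 >= 2 b w2 (s_i^2 + s_(i+1)^2)] since [b < 0]; the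
   coefficient of [s_i^2] is then a + 4b - 2b [jump i], at least a + 5b. *)
apply (sumZ_le_periodic N _ _ (fun i =>
  b * w2 chi (i - 1) * (s (i - 1)%Z * s i - s i * s i))); trivial.
- intros i; rewrite Hs.
  rewrite (periodic_shift N s (-1) Hs : forall j, s (j + 2 * N - 1)%Z = _).
  now rewrite (periodic_shift N _ (-1) (periodic_w2 N chi Hc)
    : forall j, w2 chi (j + 2 * N - 1)%Z = _).
- intros i; specialize (Hj i).
  assert (Hw : 0 <= w2 chi i)
    by (unfold w2; generalize (H0 i) (H0 (i + 2)%Z); lra).
  assert (Ej : jump chi i = 2 * w1 chi i - w2 chi i - w2 chi (i - 1)).
  { unfold jump, w1, w2; replace (i - 1 + 2)%Z with (i + 1)%Z by lia; field. }
  replace (i + 1 - 1)%Z with i by lia.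
  assert (H1 : 0 <= - b * w2 chi i * (s i - s (i + 1)%Z) ^ 2)
    by (apply Rmult_le_pos; [apply Rmult_le_pos; lra|apply pow2_ge_0]).
  assert (H2 : 0 <= - b * (2 * jump chi i + 1) * s i ^ 2)
    by (apply Rmult_le_pos; [apply Rmult_le_pos; lra|apply pow2_ge_0]).
  rewrite Ej in H2; unfold stress; nra.
Qed.

(** A is symmetric, so summing A r pairs [r] with the stress of the constant strain 1, which is
    [a + 4 * b - 2 * b * jump chi i]. *)
Lemma sumZ_stress (N : Z) (a b : R) (chi r : Z -> R) :
  (0 < N)%Z -> periodic N chi -> periodic N r ->
  sumZ (- N + 1) N (stress 0 0 a b chi r)
  = (a + 4 * b) * sumZ (- N + 1) N r
    + (- 2 * b) * sumZ (- N + 1) N (fun i => jump chi i * r i).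
Proof.
intros HN Hc Hr; rewrite <- sumZ_lin.
apply (sumZ_eq_periodic N _ _ (fun i =>
  b * w2 chi (i - 1) * (r i - r (i - 1)%Z))); trivial.
- intros i; rewrite Hr.
  rewrite (periodic_shift N r (-1) Hr : forall j, r (j + 2 * N - 1)%Z = _).
  now rewrite (periodic_shift N _ (-1) (periodic_w2 N chi Hc)
    : forall j, w2 chi (j + 2 * N - 1)%Z = _).
- intros i; unfold stress, jump, w1, w2.
  replace (i + 1 - 1)%Z with i by lia.
  replace (i - 1 + 2)%Z with (i + 1)%Z by lia; field.
Qed.

(** * The jump at the two interfaces *)

Lemma jump_atomistic_near (N K i : Z) :
  (2 <= K <= N - 2)%Z -> (- N <= i <= N - 1)%Z ->
  jump (atomistic N K) i = / 2 * ((if (i =? K - 1)%Z then 1 else 0)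
                      - (if (i =? K + 1)%Z then 1 else 0)
                      + (if (i =? - K)%Z then 1 else 0)
                      - (if (i =? - K - 2)%Z then 1 else 0)).
Proof.
intros HK Hi; unfold jump; rewrite !atomistic_near by lia.
destruct (Z.leb_spec (Z.abs i) K), (Z.leb_spec (Z.abs (i + 1)) K); try lia;
destruct (Z.leb_spec (Z.abs (i + 2)) K), (Z.leb_spec (Z.abs (i - 1)) K); try lia;
destruct (Z.eqb_spec i (K - 1)), (Z.eqb_spec i (K + 1)); try lia;
destruct (Z.eqb_spec i (- K)), (Z.eqb_spec i (- K - 2)); try lia; lra.
Qed.

Lemma periodic_jump_atomistic (N K : Z) : periodic N (jump (atomistic N K)).
Proof. apply periodic_jump, periodic_atomistic. Qed.

Lemma jump_atomistic_bounds (N K : Z) : (2 <= K <= N - 2)%Z ->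
  forall i, - / 2 <= jump (atomistic N K) i.
Proof.
intros HK i; rewrite <- (periodic_cell N i (jump (atomistic N K))) by (lia || apply periodic_jump_atomistic).
rewrite jump_atomistic_near by (trivial; apply cell_bounds; lia).
destruct (Z.eqb_spec (cell N i) (K - 1)), (Z.eqb_spec (cell N i) (K + 1)),
 (Z.eqb_spec (cell N i) (- K)), (Z.eqb_spec (cell N i) (- K - 2));
 try lia; lra.
Qed.

(** Periodic coordinate vectors turn pairings with the jump into evaluations at four bonds, even
    when K = N-2 and the bond -K-2 = -N lies outside the summation range. *)
Lemma jump_atomistic (N K : Z) : (2 <= K <= N - 2)%Z -> forall i,
  jump (atomistic N K) i = / 2 * (unit_disp N (K - 1) i - unit_disp N (K + 1) i
                      + unit_disp N (- K) i - unit_disp N (- K - 2) i).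
Proof.
intros HK; apply (periodic_ext N); [lia|apply periodic_jump_atomistic| |].
- intros i; now rewrite !periodic_unit_disp.
- intros i Hi; rewrite jump_atomistic_near, !unit_disp_near by lia; reflexivity.
Qed.

Lemma sumZ_jump (N K : Z) (g : Z -> R) : (2 <= K <= N - 2)%Z -> periodic N g ->
  sumZ (- N + 1) N (fun i => jump (atomistic N K) i * g i)
  = / 2 * (g (K - 1)%Z - g (K + 1)%Z + g (- K)%Z - g (- K - 2)%Z).
Proof.
intros HK Hg.
rewrite <- !(sumZ_unit_disp N _ g) by (trivial; lia).
rewrite (sumZ_ext _ _ _ (fun i =>
  / 2 * (1 * (1 * (g i * unit_disp N (K - 1) i) + (-1) * (g i * unit_disp N (K + 1) i))
         + 1 * (1 * (g i * unit_disp N (- K) i) + (-1) * (g i * unit_disp N (- K - 2) i)))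
  + 0 * 0)).
- rewrite !sumZ_lin; ring.
- intros i _; rewrite (jump_atomistic N K HK); ring.
Qed.

Lemma sumZ_jump_0 (N K : Z) : (2 <= K <= N - 2)%Z ->
  sumZ (- N + 1) N (jump (atomistic N K)) = 0.
Proof.
intros HK; transitivity (sumZ (- N + 1) N (fun i => jump (atomistic N K) i * 1)).
- apply sumZ_ext; intros; ring.
- rewrite (sumZ_jump N K (fun _ => 1) HK) by (intros i; reflexivity); ring.
Qed.

(** * The exponential profile and the interface rows *)

(** For l > 0 this is 2 l^(-1/2) cosh((m + 1/2) ln l), even about the midpoint of the bonds -1 and
    0. *)
Definition sym_pow (l : R) (m : Z) : R := powerRZ l m + powerRZ l (- 1 - m).

Lemma sym_pow_refl (l : R) (m : Z) : sym_pow l (- 1 - m) = sym_pow l m.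
Proof.
unfold sym_pow; replace (- 1 - (- 1 - m))%Z with m by lia; ring.
Qed.

(** The characteristic polynomial is palindromic, so 1/l is a root along with l and both summands
    solve the recurrence, which is a row of A inside the atomistic region. *)
Lemma sym_pow_rec (a b l : R) (m : Z) : 0 < l ->
  b * l ^ 2 + (a + 2 * b) * l + b = 0 ->
  (a + 2 * b) * sym_pow l m + b * (sym_pow l (m - 1) + sym_pow l (m + 1)) = 0.
Proof.
intros Hl H.
assert (Hn : forall k, b * powerRZ l (k + 2) + (a + 2 * b) * powerRZ l (k + 1)
   + b * powerRZ l k = 0).
{ intros k; rewrite !powerRZ_add by lra; simpl powerRZ at 2 4.
  transitivity (powerRZ l k * (b * l ^ 2 + (a + 2 * b) * l + b)); [simpl; ring|].
  rewrite H; ring. }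
assert (H1 := Hn (m - 1)%Z); assert (H2 := Hn (- 1 - (m + 1))%Z).
replace (m - 1 + 2)%Z with (m + 1)%Z in H1 by lia.
replace (m - 1 + 1)%Z with m in H1 by lia.
replace (- 1 - (m + 1) + 2)%Z with (- 1 - (m - 1))%Z in H2 by lia.
replace (- 1 - (m + 1) + 1)%Z with (- 1 - m)%Z in H2 by lia.
unfold sym_pow; lra.
Qed.

Lemma powerRZ_le_exp (l : R) (m n : Z) : 1 < l -> (m <= n)%Z ->
  powerRZ l m <= powerRZ l n.
Proof.
intros Hl H; rewrite !powerRZ_Rpower by lra.
apply Rle_Rpower; [lra|apply IZR_le, H].
Qed.

Lemma sym_pow_pos (l : R) (m : Z) : 0 < l -> 0 < sym_pow l m.
Proof.
intros Hl; unfold sym_pow.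
generalize (powerRZ_lt l m Hl) (powerRZ_lt l (- 1 - m) Hl); lra.
Qed.

(** For m >= 0 the numerator is at most 2 l^m, since -1-m <= m, and the denominator exceeds l^n. *)
Lemma sym_pow_ratio (l : R) (m n : Z) : 1 < l -> (0 <= m)%Z ->
  sym_pow l m / sym_pow l n <= 2 * powerRZ l (m - n).
Proof.
intros Hl Hm.
assert (Hp := sym_pow_pos l n ltac:(lra)).
apply (Rmult_le_reg_r (sym_pow l n)); trivial.
replace (sym_pow l m / sym_pow l n * sym_pow l n) with (sym_pow l m)
  by (field; lra).
assert (H1 := powerRZ_le_exp l (- 1 - m) m Hl ltac:(lia)).
assert (H2 := powerRZ_lt l (- 1 - n) ltac:(lra)).
assert (H3 := powerRZ_lt l (m - n) ltac:(lra)).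
assert (H4 : powerRZ l m = powerRZ l (m - n) * powerRZ l n)
  by (rewrite <- powerRZ_add by lra; f_equal; lia).
unfold sym_pow at 2; rewrite Rmult_plus_distr_l, Rmult_assoc, <- H4.
unfold sym_pow; nra.
Qed.

(** The increment from n-1 to n is (l - 1) (l^(n-1) - l^(-1-n)), nonnegative for n >= 1. *)
Lemma sym_pow_le (l : R) (m n : Z) : 1 < l -> (0 <= m <= n)%Z ->
  sym_pow l m <= sym_pow l n.
Proof.
intros Hl [Hm Hn].
revert n Hn; enough (H : forall n, (m + 1 - 1 <= n)%Z -> sym_pow l m <= sym_pow l n)
  by (intros n Hn; apply H; lia).
apply (interval_ind (m + 1) (fun n => sym_pow l m <= sym_pow l n)).
- replace (m + 1 - 1)%Z with m by lia; lra.
- intros n Hn IH; apply Rle_trans with (1 := IH); unfold sym_pow.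
  replace n with (n - 1 + 1)%Z at 3 by lia.
  replace (- 1 - (n - 1))%Z with (- 1 - n + 1)%Z by lia.
  rewrite !powerRZ_add by lra; simpl powerRZ at 3 5.
  assert (H := powerRZ_le_exp l (- 1 - n) (n - 1) Hl ltac:(lia)).
  nra.
Qed.

(* The rows K-1, K, K+1 of A r = f in the unknowns r_(K-1), r_K, r_(K+1), with
   [th] standing for r_(K-2) / r_(K-1). *)
Lemma interface_system (a b th : R) :
  b < 0 -> 0 < a + 5 * b -> 0 <= th <= 1 ->
  exists x y z : R,
    (a + 3 / 2 * b + b * th) * x + b / 2 * y = / 2 /\
    b / 2 * x + (a + 3 * b) * y + b / 2 * z = 0 /\
    b / 2 * y + (a + 9 / 2 * b) * z = - / 2 /\
    (a + 5 * b) * Rabs x <= / 2 /\ (a + 5 * b) * Rabs z <= / 2.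
Proof.
intros Hb Hm Hth.
set (d1 := a + 3 / 2 * b + b * th); set (d3 := a + 9 / 2 * b).
assert (H1 : a + 5 * b - b / 2 <= d1) by (unfold d1; nra).
assert (H3 : d3 = a + 5 * b - b / 2) by (unfold d3; field).
assert (Hs : forall d, a + 5 * b - b / 2 <= d ->
  0 <= b / 2 * (b / 2) / d <= - b / 2).
{ intros d Hd; split.
  - apply Rle_mult_inv_pos; nra.
  - apply (Rmult_le_reg_r d); [lra|].
    replace (b / 2 * (b / 2) / d * d) with (b / 2 * (b / 2)) by (field; lra).
    nra. }
assert (Hs1 := Hs d1 H1); assert (Hs3 := Hs d3 ltac:(lra)).
(* Schur complement of the middle row after eliminating [x] and [z]; each correction is at most
   -b/2, so e >= a + 4b > 0. *)
set (e := a + 3 * b - b / 2 * (b / 2) / d1 - b / 2 * (b / 2) / d3).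
assert (He : 0 < e) by (unfold e; lra).
set (y := - (b / 2) * (/ 2 / d1 - / 2 / d3) / e).
set (x := (/ 2 - b / 2 * y) / d1); set (z := (- / 2 - b / 2 * y) / d3).
assert (E1 : d1 * x + b / 2 * y = / 2) by (unfold x; field; lra).
assert (E3 : b / 2 * y + d3 * z = - / 2) by (unfold z; field; lra).
assert (E2 : b / 2 * x + (a + 3 * b) * y + b / 2 * z = 0).
{ transitivity (e * y + b / 2 * (/ 2 / d1 - / 2 / d3)).
  - unfold e, x, z; field; lra.
  - unfold y; field; lra. }
(* Each row is diagonally dominant with margin at least a + 5b and right-hand side at most 1/2 in
   size, so all unknowns are bounded by 1/2 over that margin. *)
exists x, y, z; repeat split; trivial;
  unfold Rabs; destruct (Rcase_abs x), (Rcase_abs z), (Rle_dec 0 y); nra.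
Qed.

(** * Reflection symmetry and the solution of A r = f *)

Lemma cell_reflect (N j : Z) : (0 < N)%Z -> cell N (- 1 - j) = (- 1 - cell N j)%Z.
Proof.
intros HN; destruct (cell_decomp N j HN) as [k Hk].
assert (Hb := cell_bounds N j HN).
replace (- 1 - j)%Z with (- 1 - cell N j + 2 * N * (- k))%Z by lia.
rewrite cell_add; apply cell_id; lia.
Qed.

Lemma stress_reflect (a b : R) (chi r : Z -> R) (i : Z) :
  (forall j, (i - 1 <= j <= i + 2)%Z -> chi (- j)%Z = chi j) ->
  (forall j, r (- 1 - j)%Z = r j) ->
  stress 0 0 a b chi r (- 1 - i) = stress 0 0 a b chi r i.
Proof.
intros Hc Hr; unfold stress, w1, w2.
replace (- 1 - i + 1)%Z with (- i)%Z by lia.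
replace (- 1 - i - 1 + 2)%Z with (- i)%Z by lia.
replace (- 1 - i + 2)%Z with (- (i - 1))%Z by lia.
replace (- 1 - i - 1)%Z with (- (i + 2))%Z by lia.
replace (i - 1 + 2)%Z with (i + 1)%Z by lia.
rewrite !(Hc i), !(Hc (i - 1)%Z), !(Hc (i + 2)%Z) by lia.
replace (chi (- 1 - i)%Z) with (chi (i + 1)%Z)
  by (rewrite <- Hc by lia; f_equal; lia).
rewrite <- (Hr (- i)%Z), <- (Hr (- (i + 2))%Z), (Hr i).
replace (- 1 - - i)%Z with (i - 1)%Z by lia.
replace (- 1 - - (i + 2))%Z with (i + 1)%Z by lia.
ring.
Qed.

(** The profile is glued from a multiple of [sym_pow] up to bond K-1, two values from
    [interface_system] at K and K+1, and zero beyond; reflection about atom 0 supplies the negative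
    bonds. *)
Lemma interface_solution (N K : Z) (a b l : R) :
  (2 <= K <= N - 2)%Z -> b < 0 -> 0 < a + 5 * b ->
  1 < l -> b * l ^ 2 + (a + 2 * b) * l + b = 0 ->
  exists r : Z -> R,
    periodic N r /\
    (forall i, stress 0 0 a b (atomistic N K) r i = jump (atomistic N K) i) /\
    (forall i, (K + 2 <= i <= N - 1)%Z -> r i = 0) /\
    (forall i, (0 <= i <= K - 1)%Z ->
       (a + 5 * b) * Rabs (r i) <= powerRZ l (i - (K - 1))) /\
    (a + 5 * b) * Rabs (r (K - 1)%Z - r (K + 1)%Z + r (- K)%Z - r (- K - 2)%Z) <= 2.
Proof.
intros HK Hb Hm Hl Hroot.
assert (Hk1 := sym_pow_pos l (K - 1) ltac:(lra)).
set (th := sym_pow l (K - 2) / sym_pow l (K - 1)).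
assert (Hth : 0 <= th <= 1).
{ assert (H1 := sym_pow_pos l (K - 2) ltac:(lra)).
  assert (H2 := sym_pow_le l (K - 2) (K - 1) Hl ltac:(lia)).
  split; [apply Rle_mult_inv_pos; lra|].
  apply (Rmult_le_reg_r (sym_pow l (K - 1))); trivial.
  replace (th * sym_pow l (K - 1)) with (sym_pow l (K - 2))
    by (unfold th; field; lra); lra. }
destruct (interface_system a b th Hb Hm Hth) as (x & y & z & E1 & E2 & E3 & Bx & Bz).
set (rho := fun m => if (m <=? K - 1)%Z then x * (sym_pow l m / sym_pow l (K - 1))
  else if (m =? K)%Z then y else if (m =? K + 1)%Z then z else 0).
(* [Z.max c (- 1 - c)] reflects [r] about atom 0, which swaps the bonds [c]
   and [- 1 - c]. *)
set (r := fun i => rho (Z.max (cell N i) (- 1 - cell N i))).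
assert (Hper : periodic N r)
  by exact (periodic_cell_fun N (fun c => rho (Z.max c (- 1 - c)))).
assert (Hrefl : forall i, r (- 1 - i)%Z = r i).
{ intros i; unfold r; rewrite cell_reflect by lia; f_equal; lia. }
assert (Hin : forall i, (0 <= i <= K - 1)%Z ->
  r i = x * (sym_pow l i / sym_pow l (K - 1))).
{ intros i Hi; unfold r; rewrite cell_id, Z.max_l by lia; unfold rho.
  destruct (Z.leb_spec i (K - 1)); trivial; lia. }
(* Row 0 reaches bond -1, the mirror image of bond 0; [sym_pow] has the same symmetry. *)
assert (Hin' : forall i, (- 1 <= i <= K - 1)%Z ->
  r i = x * (sym_pow l i / sym_pow l (K - 1))).
{ intros i Hi; destruct (Z.eq_dec i (- 1)) as [->|Hne]; [|apply Hin; lia].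
  rewrite <- (Hrefl (-1)%Z), <- (sym_pow_refl l (-1)); apply Hin; lia. }
assert (HK0 : r K = y).
{ unfold r; rewrite cell_id, Z.max_l by lia; unfold rho.
  destruct (Z.leb_spec K (K - 1)), (Z.eqb_spec K K); trivial; lia. }
assert (HK1 : r (K + 1)%Z = z).
{ unfold r; rewrite cell_id, Z.max_l by lia; unfold rho.
  destruct (Z.leb_spec (K + 1) (K - 1)), (Z.eqb_spec (K + 1) K),
    (Z.eqb_spec (K + 1) (K + 1)); trivial; lia. }
assert (Hout : forall i, (K + 2 <= i <= N - 1)%Z -> r i = 0).
{ intros i Hi; unfold r; rewrite cell_id, Z.max_l by lia; unfold rho.
  destruct (Z.leb_spec i (K - 1)), (Z.eqb_spec i K), (Z.eqb_spec i (K + 1));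
    trivial; lia. }
assert (Hx : r (K - 1)%Z = x) by (rewrite Hin by lia; field; lra).
exists r; repeat split; trivial.
- set (chi := atomistic N K).
  assert (Hrow : forall i, (0 <= i <= N - 1)%Z ->
    stress 0 0 a b chi r i = jump chi i).
  { intros i Hi; unfold chi at 2; rewrite jump_atomistic_near by lia.
    unfold stress, w1, w2, chi.
    replace (i - 1 + 2)%Z with (i + 1)%Z by lia.
    rewrite !atomistic_near by lia.
    destruct (Z.eqb_spec i (- K)), (Z.eqb_spec i (- K - 2)); try lia.
    destruct (Z_le_gt_dec i (K - 2)) as [H2|H2].
    { destruct (Z.leb_spec (Z.abs i) K), (Z.leb_spec (Z.abs (i + 1)) K),
        (Z.leb_spec (Z.abs (i + 2)) K), (Z.leb_spec (Z.abs (i - 1)) K),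
        (Z.eqb_spec i (K - 1)), (Z.eqb_spec i (K + 1)); try lia.
      rewrite !Hin' by lia.
      assert (Hrec := sym_pow_rec a b l i ltac:(lra) Hroot).
      transitivity (x / sym_pow l (K - 1) * ((a + 2 * b) * sym_pow l i
        + b * (sym_pow l (i - 1) + sym_pow l (i + 1)))); [field; lra|].
      rewrite Hrec; field; lra. }
    destruct (Z.eq_dec i (K - 1)) as [->|H3].
    { replace (K - 1 + 1)%Z with K by lia.
      replace (K - 1 + 2)%Z with (K + 1)%Z by lia.
      replace (K - 1 - 1)%Z with (K - 2)%Z by lia.
      destruct (Z.leb_spec (Z.abs (K - 1)) K), (Z.leb_spec (Z.abs K) K),
        (Z.leb_spec (Z.abs (K + 1)) K), (Z.leb_spec (Z.abs (K - 2)) K),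
        (Z.eqb_spec (K - 1) (K - 1)), (Z.eqb_spec (K - 1) (K + 1)); try lia.
      rewrite Hx, HK0, Hin' by lia; fold th; lra. }
    destruct (Z.eq_dec i K) as [->|H4].
    { destruct (Z.leb_spec (Z.abs (K - 1)) K), (Z.leb_spec (Z.abs K) K),
        (Z.leb_spec (Z.abs (K + 1)) K), (Z.leb_spec (Z.abs (K + 2)) K),
        (Z.eqb_spec K (K - 1)), (Z.eqb_spec K (K + 1)); try lia.
      rewrite Hx, HK0, HK1; lra. }
    destruct (Z.eq_dec i (K + 1)) as [->|H5].
    { replace (K + 1 - 1)%Z with K by lia.
      replace (K + 1 + 1)%Z with (K + 2)%Z by lia.
      replace (K + 1 + 2)%Z with (K + 3)%Z by lia.
      destruct (Z.leb_spec (Z.abs (K + 3)) K), (Z.leb_spec (Z.abs K) K),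
        (Z.leb_spec (Z.abs (K + 1)) K), (Z.leb_spec (Z.abs (K + 2)) K),
        (Z.eqb_spec (K + 1) (K - 1)), (Z.eqb_spec (K + 1) (K + 1)); try lia.
      rewrite HK0, HK1; lra. }
    (* From bond K+2 on all weights vanish, so the row is decoupled from its neighbours. *)
    destruct (Z.leb_spec (Z.abs i) K), (Z.leb_spec (Z.abs (i + 1)) K),
      (Z.leb_spec (Z.abs (i + 2)) K), (Z.leb_spec (Z.abs (i - 1)) K),
      (Z.eqb_spec i (K - 1)), (Z.eqb_spec i (K + 1)); try lia.
    rewrite (Hout i) by lia; lra. }
  apply (periodic_ext N); [lia| | |].
  + apply periodic_stress; trivial; apply periodic_atomistic.
  + apply periodic_jump_atomistic.
  + intros i Hi; destruct (Z_le_gt_dec 0 i) as [H0|H0]; [apply Hrow; lia|].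
    replace i with (- 1 - (- 1 - i))%Z at 1 by lia.
    rewrite stress_reflect, Hrow; trivial; try lia.
    * unfold chi; rewrite !jump_atomistic_near by lia.
      destruct (Z.eqb_spec i (K - 1)), (Z.eqb_spec i (K + 1)),
        (Z.eqb_spec i (- K)), (Z.eqb_spec i (- K - 2)),
        (Z.eqb_spec (- 1 - i) (K - 1)), (Z.eqb_spec (- 1 - i) (K + 1)),
        (Z.eqb_spec (- 1 - i) (- K)), (Z.eqb_spec (- 1 - i) (- K - 2));
        try lia; lra.
    * intros j Hj; unfold chi; rewrite !atomistic_near by lia.
      now rewrite Z.abs_opp.
(* The factor 2 of [sym_pow_ratio] cancels the 1/2 in [Bx]. *)
- intros i Hi; rewrite Hin by lia; rewrite Rabs_mult.
  assert (Hr := sym_pow_ratio l i (K - 1) Hl ltac:(lia)).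
  assert (Hp := sym_pow_pos l i ltac:(lra)).
  assert (Hq : 0 < sym_pow l i / sym_pow l (K - 1)) by (apply Rdiv_lt_0_compat; lra).
  rewrite (Rabs_pos_eq (_ / _)) by lra.
  assert (H := Rabs_pos x); nra.
(* By reflection the combination is 2 (x - z). *)
- rewrite <- (Hrefl (- K)%Z), <- (Hrefl (- K - 2)%Z).
  replace (- 1 - - K)%Z with (K - 1)%Z by lia.
  replace (- 1 - (- K - 2))%Z with (K + 1)%Z by lia.
  rewrite Hx, HK1; revert Bx Bz; unfold Rabs.
  destruct (Rcase_abs x), (Rcase_abs z), (Rcase_abs _); nra.
Qed.

(** * Displacements with a given strain, equilibria and uniqueness *)

Lemma strain_potential (N : Z) (s : Z -> R) : (0 < N)%Z -> periodic N s ->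
  sumZ (- N + 1) N s = 0 ->
  exists u : Z -> R, periodic N u /\ sumZ (- N + 1) N u = 0 /\
    forall j, strain N u j = s j.
Proof.
intros HN Hs H0.
assert (Hm := mesh_pos N HN).
set (U := fun j => sumZ (- N) (cell N j - 1) s).
assert (HU : periodic N U)
  by exact (periodic_cell_fun N (fun c => sumZ (- N) (c - 1) s)).
set (m := sumZ (- N + 1) N U / IZR (2 * N)).
set (u := fun j => mesh N * U j + (- mesh N * m) * 1).
assert (Hu : periodic N u) by (intros j; unfold u; now rewrite HU).
exists u; split; [exact Hu|split].
- unfold u; rewrite sumZ_lin, sumZ_const by lia.
  replace (N - (- N + 1) + 1)%Z with (2 * N)%Z by lia.
  unfold m; field; apply not_0_IZR; lia.
- assert (HUs : forall j, U (j + 1)%Z - U j = s j).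
  { apply (periodic_ext N); trivial.
    - intros j; rewrite HU; f_equal; apply (periodic_shift N U 1 HU).
    (* At the seam j = N-1 the partial sums restart from zero; the vanishing period sum of [s]
       closes the gap. *)
    - intros j Hj; destruct (Z.eq_dec j (N - 1)) as [->|Hne].
      + replace (N - 1 + 1)%Z with (- N + 2 * N)%Z by lia.
        rewrite HU; unfold U; rewrite !cell_id, (sumZ_nil _ (- N - 1)) by lia.
        rewrite (sumZ_last (- N + 1) N) in H0 by lia.
        rewrite (sumZ_last (- N + 1) (N - 1)) in H0 by lia.
        rewrite (sumZ_cat (- N) (- N) (N - 1 - 1)) by lia.
        rewrite (sumZ_last (- N) (- N)), (sumZ_nil (- N)) by lia.
        replace (s (- N)%Z) with (s N)
          by (rewrite <- (Hs (- N)%Z); f_equal; lia).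
        lra.
      + unfold U; rewrite !cell_id, (sumZ_last (- N) (j + 1 - 1)) by lia.
        replace (j + 1 - 1)%Z with j by lia; ring. }
  intros j; rewrite <- HUs; unfold strain, u; field; lra.
Qed.

Lemma equilibrium_stress (phi : R -> R) (F : R) (N K : Z) (u : Z -> R) :
  (2 <= K <= N - 2)%Z -> periodic N u ->
  let sigma := stress (dphi phi F) (dphi phi (2 * F)) (ddphi phi F)
                 (ddphi phi (2 * F)) (atomistic N K) (strain N u) in
  forall j, Lqc phi F N K u j - ghost phi F N K j
            = / mesh N * (sigma (j - 1)%Z - sigma j).
Proof.
intros HK Hu sigma j; unfold Lqc.
rewrite dEqc_explicit, dE_stress; trivial; [|apply periodic_unit_disp].
assert (Hsig : periodic N sigma)
  by (apply periodic_stress; [apply periodic_atomistic|apply periodic_strain, Hu]).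
fold sigma; rewrite (sumZ_unit_disp N j (fun j => sigma (j - 1)%Z - sigma j)).
- ring.
- lia.
- intros i; rewrite Hsig; f_equal.
  apply (periodic_shift N sigma (-1) Hsig).
Qed.

Lemma equilibrium_constant (phi : R -> R) (F : R) (N K : Z) (u : Z -> R) :
  (2 <= K <= N - 2)%Z -> is_uqc phi F N K u ->
  forall j, stress (dphi phi F) (dphi phi (2 * F)) (ddphi phi F)
      (ddphi phi (2 * F)) (atomistic N K) (strain N u) j
    = stress (dphi phi F) (dphi phi (2 * F)) (ddphi phi F)
      (ddphi phi (2 * F)) (atomistic N K) (strain N u) (- N).
Proof.
intros HK (Hu & _ & Heq).
set (sigma := stress _ _ _ _ _ _).
assert (Hsig : periodic N sigma)
  by (apply periodic_stress; [apply periodic_atomistic|apply periodic_strain, Hu]).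
apply (periodic_ext N); [lia|exact Hsig|intros j; reflexivity|].
enough (H : forall j, (- N + 1 - 1 <= j)%Z -> (j <= N - 1)%Z -> sigma j = sigma (- N)%Z)
  by (intros j Hj; apply H; lia).
apply (interval_ind (- N + 1) (fun j => (j <= N - 1)%Z -> sigma j = sigma (- N)%Z)).
- intros _; f_equal; lia.
- intros j Hj IH HjN; rewrite <- IH by lia.
  assert (H := Heq j ltac:(lia)).
  rewrite equilibrium_stress in H by assumption; fold sigma in H.
  assert (Hm := Rinv_0_lt_compat _ (mesh_pos N ltac:(lia))).
  apply Rmult_integral in H; lra.
Qed.

(** The difference [d] of the strains has constant stress and zero sum, so <A d, d> = 0 and
    coercivity gives d = 0; then v - u is constant with mean zero. *)
Lemma uqc_unique (phi : R -> R) (F : R) (N K : Z) (u v : Z -> R) :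
  ddphi phi (2 * F) < 0 -> 0 < ddphi phi F + 5 * ddphi phi (2 * F) ->
  (2 <= K <= N - 2)%Z -> is_uqc phi F N K u -> is_uqc phi F N K v ->
  forall j, v j = u j.
Proof.
intros Hb Hm HK HUu HUv.
assert (Cu := equilibrium_constant _ _ _ _ _ HK HUu).
assert (Cv := equilibrium_constant _ _ _ _ _ HK HUv).
destruct HUu as (Hu & Su & _), HUv as (Hv & Sv & _).
assert (Hmesh := mesh_pos N ltac:(lia)).
set (a := ddphi phi F) in *; set (b := ddphi phi (2 * F)) in *.
set (chi := atomistic N K) in *.
set (d := fun j => strain N v j - strain N u j).
assert (Hd : periodic N d).
{ intros j; unfold d; now rewrite !periodic_strain. }
assert (Hsum : sumZ (- N + 1) N d = 0).
{ transitivity (sumZ (- N + 1) N (fun _ => 0)).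
  - apply (sumZ_eq_periodic N _ _ (fun j => (v j - u j) / mesh N)); [lia| |].
    + intros j; now rewrite Hu, Hv.
    + intros j; unfold d, strain, Rdiv; ring.
  - rewrite sumZ_const by lia; ring. }
assert (Hchi : forall i, 0 <= chi i)
  by (intros i; destruct (atomistic_01 N K i) as [E|E]; unfold chi; rewrite E; lra).
assert (Hco := stress_coercive N a b chi d ltac:(lia) Hb
  (periodic_atomistic N K) Hd Hchi (jump_atomistic_bounds N K HK)).
set (tau := stress 0 0 a b chi d (- N)).
assert (Hst : forall j, stress 0 0 a b chi d j = tau).
{ intros j; unfold tau, d.
  rewrite <- !(stress_minus (dphi phi F) (dphi phi (2 * F))).
  now rewrite Cu, Cv. }
rewrite (sumZ_ext _ _ (fun i => stress 0 0 a b chi d i * d i)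
  (fun i => tau * d i + 0 * d i)) in Hco by (intros; rewrite Hst; ring).
rewrite sumZ_lin, Hsum in Hco.
assert (Hd0 : forall j, d j = 0).
{ intros j.
  (* [unit_disp] takes values in {0, 1}, so the single square is at most the sum of all squares,
     which [Hco] makes nonpositive. *)
  assert (Hp := sumZ_unit_disp N j (fun i => d i * d i) ltac:(lia)).
  rewrite <- Rsqr_0_uniq with (r := d j); trivial.
  unfold Rsqr; rewrite <- Hp by (intros i; now rewrite Hd).
  apply Rle_antisym.
  - apply Rle_trans with (sumZ (- N + 1) N (fun i => d i * d i)).
    + apply sumZ_le; intros i; unfold unit_disp.
      generalize (Rle_0_sqr (d i)); unfold Rsqr; destruct (Z.eqb _ _); nra.
    + nra.
  - apply sumZ_nonneg; intros i; unfold unit_disp.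
    generalize (Rle_0_sqr (d i)); unfold Rsqr; destruct (Z.eqb _ _); nra. }
set (e := fun j => v j - u j).
assert (Hstep : forall j, e (j + 1)%Z = e j).
{ intros j; specialize (Hd0 j); unfold d, strain in Hd0.
  assert (H : (e (j + 1)%Z - e j) / mesh N = 0) by (rewrite <- Hd0; unfold e, Rdiv; ring).
  apply Rmult_integral in H; destruct H as [H|H]; [lra|].
  generalize (Rinv_0_lt_compat _ Hmesh); lra. }
assert (Hconst : forall j, e j = e 0%Z).
{ apply Z.bi_induction; [intros x y ->; reflexivity|reflexivity|].
  intros j; unfold Z.succ; now rewrite Hstep. }
intros j; enough (e j = 0) by (unfold e in *; lra).
assert (Hs : sumZ (- N + 1) N (fun j => 1 * v j + (-1) * u j) = 0)
  by (rewrite sumZ_lin, Sv, Su; ring).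
rewrite (sumZ_ext _ _ _ (fun _ => e j)) in Hs.
- rewrite sumZ_const in Hs by lia.
  replace (N - (- N + 1) + 1)%Z with (2 * N)%Z in Hs by lia.
  apply Rmult_integral in Hs; destruct Hs as [Hs|Hs]; trivial.
  apply eq_IZR in Hs; lia.
- intros i _; rewrite Hconst, <- (Hconst i); unfold e; ring.
Qed.

(** * The decay rate and the logarithmic scale *)

(** [lam] is the larger characteristic root: the discriminant (a + 2b)^2 - 4b^2 is a^2 + 4ab. It
    exceeds 1 because a + 4b > 0. *)
Lemma lam_root (phi : R -> R) (F : R) :
  ddphi phi (2 * F) < 0 -> 0 < ddphi phi F + 5 * ddphi phi (2 * F) ->
  1 < lam phi F /\
  ddphi phi (2 * F) * lam phi F ^ 2
  + (ddphi phi F + 2 * ddphi phi (2 * F)) * lam phi F + ddphi phi (2 * F) = 0.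
Proof.
unfold lam; set (a := ddphi phi F); set (b := ddphi phi (2 * F)); intros Hb Hm.
set (D := a ^ 2 + 4 * a * b).
assert (HD : 0 < D) by (unfold D; nra).
assert (Hs := sqrt_sqrt D ltac:(lra)); assert (Hp := sqrt_lt_R0 D HD).
set (S := sqrt D) in *; split.
- apply (Rmult_lt_reg_r (- 2 * b)); [lra|].
  replace ((a + 2 * b + S) / (- 2 * b) * (- 2 * b)) with (a + 2 * b + S)
    by (field; lra); lra.
- transitivity ((S * S - D) / (4 * b)); [unfold D; field; lra|].
  rewrite Hs; field; lra.
Qed.

Lemma mesh_le (N : Z) : (4 <= N)%Z -> mesh N <= / 4.
Proof. intros H; apply Rinv_le_contravar; [lra|apply IZR_le, H]. Qed.

(** Here h <= 1/4 < 1/e; additive constants can thus be absorbed into multiples of |ln h|. *)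
Lemma ln_mesh_le (N : Z) : (4 <= N)%Z -> ln (mesh N) <= - 1.
Proof.
intros H; rewrite <- (ln_exp (- 1)); apply ln_le; [apply mesh_pos; lia|].
apply Rle_trans with (1 := mesh_le N H).
replace (- 1) with (- (1)) by ring.
rewrite exp_Ropp; apply Rinv_le_contravar; [apply exp_pos|].
generalize exp_le_3; lra.
Qed.

Lemma powerRZ_le_mesh (l : R) (N K j : Z) : 1 < l -> (0 < N)%Z ->
  IZR j <= IZR K + ln (mesh N) / ln l -> powerRZ l (j - K) <= mesh N.
Proof.
intros Hl HN Hj.
assert (Hln : 0 < ln l) by (rewrite <- ln_1; apply ln_increasing; lra).
rewrite powerRZ_Rpower by lra; unfold Rpower.
rewrite <- (exp_ln (mesh N)) by (apply mesh_pos, HN).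
apply Rnot_lt_le; intros Hlt; apply exp_lt_inv in Hlt.
revert Hlt; apply Rle_not_lt; rewrite minus_IZR.
apply (Rmult_le_reg_r (/ ln l)); [apply Rinv_0_lt_compat, Hln|].
rewrite Rmult_assoc, Rinv_r, Rmult_1_r by lra; unfold Rdiv in Hj; lra.
Qed.

(** [up] is the least integer strictly above its argument, so the list lies in the integers from
    [up x] to [up y - 1]. *)
Lemma NoDup_interval_length (l : list Z) (x y : R) : NoDup l -> x <= y ->
  (forall j, In j l -> x < IZR j < y) -> INR (length l) <= y - x + 1.
Proof.
intros Hnd Hxy Hin.
set (n := Z.to_nat (up y - up x)).
assert (Hx := archimed x); assert (Hy := archimed y).
assert (Hlen : (length l <= n)%nat).
{ replace n with (length (map (fun i => up x + Z.of_nat i)%Z (seq 0 n)))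
    by (now rewrite length_map, length_seq).
  apply NoDup_incl_length; trivial; intros j Hj.
  specialize (Hin j Hj); apply in_map_iff.
  assert (H1 : (up x - 1 < j)%Z) by (apply lt_IZR; rewrite minus_IZR; lra).
  assert (H2 : (j < up y)%Z) by (apply lt_IZR; lra).
  exists (Z.to_nat (j - up x)); split; [lia|apply in_seq; lia]. }
apply le_INR in Hlen; apply Rle_trans with (1 := Hlen).
unfold n; destruct (Z_le_gt_dec (up x) (up y)) as [H|H].
- rewrite INR_IZR_INZ, Z2Nat.id, minus_IZR by lia; lra.
- replace (Z.to_nat (up y - up x)) with 0%nat by lia; simpl; lra.
Qed.

(** * The strain estimate and the interface size *)

Lemma uqc_estimate (phi : R -> R) (F : R) :
  ddphi phi (2 * F) < 0 -> 0 < ddphi phi F + 5 * ddphi phi (2 * F) ->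
  exists C : R, 0 < C /\
    forall N K : Z, (2 <= K <= N - 2)%Z ->
      exists u : Z -> R,
        is_uqc phi F N K u /\
        forall j : Z,
          (0 <= j)%Z /\ IZR j <= IZR K + ln (mesh N) / ln (lam phi F) \/
          (K + 2 <= j <= N - 1)%Z ->
          Rabs (strain N u j) <= C * mesh N.
Proof.
intros Hb Hm; destruct (lam_root phi F Hb Hm) as [Hl Hroot].
set (p := dphi phi F); set (q := dphi phi (2 * F)).
set (a := ddphi phi F) in *; set (b := ddphi phi (2 * F)) in *.
set (l := lam phi F) in *.
set (mu := a + 5 * b) in *.
(* [T] bounds |s0| / h: it is |q| times half of the bound on |S| proved below. *)
set (T := Rabs q * (- b / ((a + 4 * b) * mu))).
assert (Hc : 0 < a + 4 * b) by (unfold mu in Hm; lra).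
assert (HT : 0 <= T).
{ apply Rmult_le_pos; [apply Rabs_pos|].
  apply Rle_mult_inv_pos; [lra|apply Rmult_lt_0_compat; lra]. }
(* The first factor bounds |q + 2 b s0|, the second bounds |r_j| / h; [l] enters because the decay
   of [r] is measured from K-1 and the threshold from K. *)
set (G := (Rabs q - 2 * b * T) * (l / mu)).
assert (HG : 0 <= G).
{ apply Rmult_le_pos; [generalize (Rabs_pos q); nra|].
  apply Rle_mult_inv_pos; lra. }
exists (T + G + 1); split; [lra|]; intros N K HK.
destruct (interface_solution N K a b l HK Hb Hm Hl Hroot)
  as (r & Hr & Hst & Hout & Hin & Hdiff).
fold mu in Hin, Hdiff.
assert (Hh := mesh_pos N ltac:(lia)); assert (Hh4 := mesh_le N ltac:(lia)).
set (S := sumZ (- N + 1) N r).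
set (Q := sumZ (- N + 1) N (fun i => jump (atomistic N K) i * r i)).
assert (HQ : mu * Rabs Q <= 1).
{ unfold Q; rewrite sumZ_jump by assumption.
  rewrite Rabs_mult, (Rabs_pos_eq (/ 2)) by lra; lra. }
assert (HSQ : (a + 4 * b) * S = 2 * b * Q).
{ assert (H := sumZ_stress N a b (atomistic N K) r ltac:(lia)
    (periodic_atomistic N K) Hr).
  rewrite (sumZ_ext _ _ (stress _ _ _ _ _ _) (jump (atomistic N K))) in H by (intros; apply Hst).
  rewrite sumZ_jump_0 in H by assumption; fold S Q in H; lra. }
assert (HQ0 : 0 <= Q).
{ assert (Hchi : forall i, 0 <= atomistic N K i)
    by (intros i; destruct (atomistic_01 N K i) as [E|E]; rewrite E; lra).
  assert (H := stress_coercive N a b (atomistic N K) r ltac:(lia) Hb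
    (periodic_atomistic N K) Hr Hchi (jump_atomistic_bounds N K HK)).
  rewrite (sumZ_ext _ _ (fun i => stress _ _ _ _ _ _ i * r i)
    (fun i => jump (atomistic N K) i * r i)) in H
    by (intros; now rewrite Hst).
  fold Q mu in H; apply Rle_trans with (2 := H).
  apply Rmult_le_pos; [lra|]; apply sumZ_nonneg; intros i; apply Rle_0_sqr. }
assert (HbS : 0 <= b * S) by nra.
assert (HN : IZR (2 * N) = 2 / mesh N)
  by (unfold mesh; rewrite mult_IZR; field; apply not_0_IZR; lia).
(* Mean zero reads s0 (2N + 2bS) = -qS; since b S >= 0, [den] is at least 2/h. *)
set (den := 2 / mesh N + 2 * (b * S)).
assert (Hden : 0 < 2 / mesh N) by (apply Rdiv_lt_0_compat; lra).
set (s0 := - (q * S) / den).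
assert (HS : Rabs S <= 2 * (- b / ((a + 4 * b) * mu))).
{ apply (Rmult_le_reg_l ((a + 4 * b) * mu)); [apply Rmult_lt_0_compat; lra|].
  replace ((a + 4 * b) * mu * (2 * (- b / ((a + 4 * b) * mu)))) with (2 * - b * 1)
    by (field; lra).
  replace ((a + 4 * b) * mu * Rabs S) with (2 * - b * (mu * Rabs Q)).
  - apply Rmult_le_compat_l; lra.
  - transitivity (mu * Rabs ((a + 4 * b) * S)).
    + rewrite HSQ, !Rabs_mult, (Rabs_left b), (Rabs_pos_eq 2) by lra; ring.
    + rewrite Rabs_mult, (Rabs_pos_eq (a + 4 * b)) by lra; ring. }
assert (Hs0 : Rabs s0 <= T * mesh N).
{ unfold s0, Rdiv; rewrite Rabs_mult, Rabs_Ropp, Rabs_mult, Rabs_inv.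
  rewrite (Rabs_pos_eq den) by (unfold den; lra).
  apply Rle_trans with (Rabs q * (2 * (- b / ((a + 4 * b) * mu))) * / (2 / mesh N)).
  - apply Rmult_le_compat.
    + apply Rmult_le_pos; apply Rabs_pos.
    + left; apply Rinv_0_lt_compat; unfold den; lra.
    + apply Rmult_le_compat_l; [apply Rabs_pos|exact HS].
    + apply Rinv_le_contravar; unfold den; lra.
  - right; unfold T; field; lra. }
set (g := q + 2 * b * s0).
set (s := fun i => s0 + g * r i).
assert (Hs : periodic N s) by (intros i; unfold s; now rewrite Hr).
assert (Hsum : sumZ (- N + 1) N s = 0).
{ rewrite (sumZ_ext _ _ _ (fun i => s0 * 1 + g * r i)) by (intros; unfold s; ring).
  rewrite sumZ_lin, sumZ_const by lia.
  replace (N - (- N + 1) + 1)%Z with (2 * N)%Z by lia; rewrite HN; fold S.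
  transitivity (s0 * den + q * S); [unfold g, den; ring|].
  unfold s0; field; unfold den; lra. }
destruct (strain_potential N s ltac:(lia) Hs Hsum) as (u & Hu & Hu0 & Hus).
assert (Hsig : forall i, stress p q a b (atomistic N K) (strain N u) i
  = p + 2 * q + (a + 4 * b) * s0).
{ intros i.
  transitivity (stress p q a b (atomistic N K) s i).
  - unfold stress; now rewrite !Hus.
  - unfold s; rewrite stress_affine, Hst; unfold g; ring. }
exists u; split; [split; [exact Hu|split; [exact Hu0|]]|].
- intros j _; rewrite equilibrium_stress by assumption.
  fold p q a b; rewrite !Hsig; ring.
- intros j Hj; rewrite Hus; unfold s.
  apply Rle_trans with (1 := Rabs_triang _ _); rewrite Rabs_mult.
  enough (Rabs g * Rabs (r j) <= G * mesh N) by nra.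
  destruct Hj as [[Hj0 Hj]|Hj].
  2: { rewrite Hout, Rabs_R0 by assumption; nra. }
  (* As ln h < 0, the first index range ends before K, where the decay estimate on [r] applies. *)
  assert (HjK : (j <= K - 1)%Z).
  { assert (Hln : 0 < ln l) by (rewrite <- ln_1; apply ln_increasing; lra).
    assert (Hlm := ln_mesh_le N ltac:(lia)).
    assert (0 < - ln (mesh N) / ln l) by (apply Rdiv_lt_0_compat; lra).
    enough (j < K)%Z by lia; apply lt_IZR; unfold Rdiv in *; lra. }
  assert (Hrj := Hin j ltac:(lia)).
  replace (j - (K - 1))%Z with (j - K + 1)%Z in Hrj by lia.
  rewrite powerRZ_add, powerRZ_1 in Hrj by lra.
  assert (Hpow := powerRZ_le_mesh l N K j Hl ltac:(lia) Hj).
  assert (Hs0T : Rabs s0 <= T) by nra.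
  assert (Hg : Rabs g <= Rabs q - 2 * b * T).
  { unfold g; apply Rle_trans with (1 := Rabs_triang _ _).
    rewrite !Rabs_mult, (Rabs_left b), (Rabs_pos_eq 2) by lra; nra. }
  assert (Hrj' : Rabs (r j) <= l / mu * mesh N).
  { apply (Rmult_le_reg_l mu); trivial.
    apply Rle_trans with (1 := Hrj).
    replace (mu * (l / mu * mesh N)) with (mesh N * l) by (field; lra).
    apply Rmult_le_compat_r; lra. }
  unfold G; rewrite Rmult_assoc.
  apply Rmult_le_compat; trivial; apply Rabs_pos.
Qed.

Lemma interface_size (phi : R -> R) (F : R) : 1 < lam phi F ->
  exists C : R, 0 < C /\
    forall N K : Z, (2 <= K <= N - 2)%Z ->
      (forall l : list Z, NoDup l ->
         (forall j : Z, In j l -> in_interface phi F N K j) ->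
         mesh N * INR (length l) <= C * (mesh N * Rabs (ln (mesh N)))) /\
      (forall i j : Z,
         in_interface phi F N K i -> in_interface phi F N K j ->
         Rabs (mesh N * IZR i - mesh N * IZR j)
           <= C * (mesh N * Rabs (ln (mesh N)))).
Proof.
intros Hl.
assert (Hln : 0 < / ln (lam phi F))
  by (apply Rinv_0_lt_compat; rewrite <- ln_1; apply ln_increasing; lra).
(* The interval has length 2 - ln h / ln lam, counting costs one more, and 3 <= 3 |ln h|. *)
exists (3 + / ln (lam phi F)); split; [lra|]; intros N K HK.
assert (Hh := mesh_pos N ltac:(lia)); assert (Hlm := ln_mesh_le N ltac:(lia)).
assert (Hneg : ln (mesh N) / ln (lam phi F) < 0) by (unfold Rdiv; nra).
assert (Hbnd : 3 - ln (mesh N) / ln (lam phi F)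
  <= (3 + / ln (lam phi F)) * Rabs (ln (mesh N)))
  by (rewrite Rabs_left by lra; unfold Rdiv; nra).
set (A := Rabs (ln (mesh N))) in *.
replace ((3 + / ln (lam phi F)) * (mesh N * A))
  with (mesh N * ((3 + / ln (lam phi F)) * A)) by ring.
split.
- intros l Hnd Hin.
  assert (H := NoDup_interval_length l
    (IZR K + ln (mesh N) / ln (lam phi F)) (IZR K + 2) Hnd ltac:(lra) Hin).
  apply Rmult_le_compat_l; lra.
- intros i j Hi Hj; unfold in_interface in Hi, Hj.
  rewrite <- Rmult_minus_distr_l, Rabs_mult, (Rabs_pos_eq (mesh N)) by lra.
  assert (Rabs (IZR i - IZR j) <= 3 - ln (mesh N) / ln (lam phi F))
    by (apply Rabs_le; lra).
  apply Rmult_le_compat_l; lra.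
Qed.

Theorem lemma3p2 :
  forall (F r0 : R) (phi : R -> R),
    0 < F ->
    0 < r0 < F ->
    C2_on (fun r => r0 <= r) phi ->
    0 < ddphi phi F ->
    ddphi phi (2 * F) < 0 ->
    0 < ddphi phi F + 5 * ddphi phi (2 * F) ->
    1 < lam phi F /\
    (exists C : R, 0 < C /\
      forall N K : Z, (2 <= K <= N - 2)%Z ->
        exists u : Z -> R,
          is_uqc phi F N K u /\
          (forall v : Z -> R, is_uqc phi F N K v -> forall j : Z, v j = u j) /\
          (forall j : Z,
             (0 <= j)%Z /\ IZR j <= IZR K + ln (mesh N) / ln (lam phi F) \/
             (K + 2 <= j <= N - 1)%Z ->
             Rabs (strain N u j) <= C * mesh N)) /\
    (exists C : R, 0 < C /\
      forall N K : Z, (2 <= K <= N - 2)%Z ->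
        (forall l : list Z, NoDup l ->
           (forall j : Z, In j l -> in_interface phi F N K j) ->
           mesh N * INR (length l) <= C * (mesh N * Rabs (ln (mesh N)))) /\
        (forall i j : Z,
           in_interface phi F N K i -> in_interface phi F N K j ->
           Rabs (mesh N * IZR i - mesh N * IZR j)
             <= C * (mesh N * Rabs (ln (mesh N))))).
Proof.
intros F r0 phi _ _ _ _ Hb Hm.
assert (Hl := proj1 (lam_root phi F Hb Hm)).
split; [exact Hl|split; [|exact (interface_size phi F Hl)]].
destruct (uqc_estimate phi F Hb Hm) as (C & HC & H).
exists C; split; [exact HC|]; intros N K HK.
destruct (H N K HK) as (u & Hu & Hbnd).
exists u; split; [exact Hu|split; [|exact Hbnd]].
intros v Hv; exact (uqc_unique phi F N K u v Hb Hm HK Hu Hv).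
Qed.
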